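(* Let $\mathcal A$ be a semiring system, and take the surpassing relation to be $\preceq\;=\;\preceq_{\mathrm{Null}}$. Suppose we are given homomorphisms $f_1:\mathcal P_1\to\mathcal M$ and $f_2:\mathcal P_2\to\mathcal M$ of $\mathcal A$-systemic modules with $f_2$ $\preceq$-onto. (i) There is a submodule $\mathcal P_\preceq=\{(b_1,b_2):f_1(b_1)\preceq f_2(b_2)\}$ of $\mathcal P_1\oplus\mathcal P_2$. Let $\pi_i$ denote the projection to $\mathcal P_i$ on the $i$-th coordinate, and $\pi_i^{\mathrm{res}}$ its restriction to $\mathcal P_\preceq$. Then $\pi_1^{\mathrm{res}}$ is onto. (ii) There is a natural homomorphism $\ker_N\pi_1^{\mathrm{res}}\to\mathcal P_2$ via $((b_1,b_2),(b_1,b_2'))\mapsto b_2(-)b_2'$, which restricts to a homomorphism $\pi:\ker_{N,\preceq}\pi_1^{\mathrm{res}}\to\mathcal P_2$ whose image is a subset of $\{b_2(-)b_2':f_2(b_2)(-)f_2(b_2')\in\mathcal M^\circ\}$. Furthermore, $\pi$ maps $\ker_{N,\preceq}\pi_1^{\mathrm{res}}$ into $\ker_{\mathrm{Mod},\mathcal P_2}f_2$. (iii) $\ker_{\mathrm{Mod},\mathcal P_\preceq}\pi_1^{\mathrm{res}}=\{(b_1,b_2)\in\mathcal P_\preceq:\ b_1\succeq 0,\ b_2\in\ker_{\mathrm{Mod},\mathcal P_2}f_2\}$. (iv) $f_1\pi_1^{\mathrm{res}}(b_1,b_2)\preceq f_2\pi_2^{\mathrm{res}}(b_1,b_2)$ for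 all $(b_1,b_2)\in\mathcal P_\preceq$.
   Context: Base definitions. Let $\mathcal T$ be a set. A $\mathcal T$-module is a commutative monoid $(\mathcal A,+,0)$ with a scalar multiplication $\mathcal T\times\mathcal A\to\mathcal A$ satisfying $a(\sum_j b_j)=\sum_j ab_j$ (finite sums) and $a0=0$. A negation map on it is a monoid isomorphism $(-):\mathcal A\to\mathcal A$ of order $\le 2$ with $(-)(ab)=a((-)b)$ for $a\in\mathcal T$, $b\in\mathcal A$. Write $b(-)c:=b+((-)c)$, $b^\circ:=b(-)b$, $\mathcal A^\circ:=\{b^\circ:b\in\mathcal A\}$. A pseudo-triple $(\mathcal A,\mathcal T_{\mathcal A},(-))$ is a $\mathcal T$-module with a negation map and a distinguished subset $\mathcal T_{\mathcal A}\subseteq\mathcal A$ (the tangible elements) with $(-)\mathcal T_{\mathcal A}=\mathcal T_{\mathcal A}$; it is a triple if moreover $\mathcal T_{\mathcal A}\cap\mathcal A^\circ=\emptyset$ and $\mathcal T_{\mathcal A}\cup\{0\}$ generates $(\mathcal A,+)$. A surpassing relation $\preceq$ is a pre-order on $\mathcal A$ such that: (i) $c^\circ\succeq 0$ for all $c$; (ii) $b_1\preceq b_2$ implies $(-)b_1\preceq(-)b_2$; (iii) $b_1\preceq b_2$ and $b_1'\preceq b_2'$ imply $b_1+b_1'\preceq b_2+b_2'$; (iv) $a\in\mathcal T$ and $b_1\preceq b_2$ imply $ab_1\preceq ab_2$; (v) $a\preceq b$ with $a,b\in\mathcal T_{\mathcal A}$ implies $a=b$. A system (resp. pseudo-system)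 $(\mathcal A,\mathcal T_{\mathcal A},(-),\preceq)$ is a triple (resp. pseudo-triple) with a surpassing relation such that for each $a\in\mathcal T_{\mathcal A}$ there is a unique $b\in\mathcal T_{\mathcal A}$ with $0\preceq a+b$, namely $b=(-)a$. Put $\mathcal A_{\mathrm{Null}}=\{a\in\mathcal A:a\succeq 0\}$, and define $b\preceq_{\mathrm{Null}}b'$ to mean $b+c=b'$ for some $c\in\mathcal A_{\mathrm{Null}}$ (and likewise for modules). Thus $\preceq\,=\,\preceq_{\mathrm{Null}}$ means that $b\preceq b'$ iff $b+c=b'$ for some $c\succeq 0$. Ground system and modules. $\mathcal A=(\mathcal A,\mathcal T,(-),\preceq)$ is a fixed semiring system: a system in which $\mathcal A$ is a semiring (with $0$ and $1$), with tangible set $\mathcal T\subseteq\mathcal A$ acting by multiplication. An $\mathcal A$-systemic module is a pseudo-system $(\mathcal M,\mathcal T_{\mathcal M},(-),\preceq)$ (with scalars $\mathcal T$) such that $\mathcal M$ is an $\mathcal A$-module, $\mathcal T_{\mathcal M}$ spans $\mathcal M$, $\mathcal T\mathcal T_{\mathcal M}\subseteq\mathcal T_{\mathcal M}$, $((-)a)m=(-)(am)$ for $a\in\mathcal A$, $m\in\mathcal M$, and $a_1b_1\preceq a_2b_2$ whenever $a_1\preceq a_2$ in $\mathcal A$ and $b_1\preceq b_2$ in $\mathcal M$. The symbol $\preceq$ is used for all surpassing relations. Direct sums and products have componentwise operations, negation and $\preceq$; submodules carry the restricted operations and relation. Morphisms. A homomorphism $\varphi:\mathcal M\to\mathcal M'$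 is a map with $\varphi(0)=0$, $\varphi((-)b)=(-)\varphi(b)$, $\varphi(b_1+b_2)=\varphi(b_1)+\varphi(b_2)$, $\varphi(ab)=a\varphi(b)$ for $a\in\mathcal T$, and $b\preceq b'\Rightarrow\varphi(b)\preceq\varphi(b')$. ''Onto'' means surjective; $f:\mathcal M\to\mathcal N$ is $\preceq$-onto if for every $y\in\mathcal N$ there is $x\in\mathcal M$ with $y\preceq f(x)$. Kernels of $f:\mathcal M\to\mathcal N$. $\ker_N f=\{(a_0,a_1)\in\mathcal M\times\mathcal M:f(a_0)=f(a_1)\}$; $\ker_{N,\preceq}f=\{(a_0,a_1)\in\mathcal M\times\mathcal M:f(a_0)=f(a_1),\ f(a_0),f(a_1)\in\mathcal N_{\mathrm{Null}}\}$. A submodule $\mathcal M'\subseteq\mathcal M$ is $f$-null if $f(\mathcal M')\subseteq\mathcal N_{\mathrm{Null}}$; $\ker_{\mathrm{Mod},\mathcal M}f$ is the sum of all $f$-null submodules of $\mathcal M$.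
   Formalization: In (ii), the printed claim that the image of π lies in {b_2(-)b_2' : f_2(b_2)(-)f_2(b_2') ∈ M°} is false in general; it is stated with M_Null in place of M°, and with M° only under the added hypothesis M_Null ⊆ M°. *)

(* Defs.v *)
From mathcomp Require Export all_boot all_algebra.
From mathcomp Require Export boolp classical_sets functions.

Set Implicit Arguments.
Unset Strict Implicit.
Unset Printing Implicit Defensive.

Export GRing.Theory.

Global Open Scope classical_set_scope.
Global Open Scope ring_scope.

(* The raw data shared by a semiring system, its systemic modules, and their
   direct sums.  The axioms are stated separately because direct sums only
   need the operations, the negation and the relation, not the tangibles. *)
Record negModule (R : pzSemiRingType) := NegModule {
  nm_sort :> lSemiModType R;
  neg : nm_sort -> nm_sort;
  prec : nm_sort -> nm_sort -> Prop
}.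

Notation "b <~ c" := (prec b c) (at level 70, no associativity).
Notation "(-) b" := (neg b) (at level 35, right associativity).
Notation "b (-) c" := (b + neg c) (at level 50, left associativity).

Section NegModules.
Variable R : pzSemiRingType.

Definition circ (M : negModule R) (b : M) : M := b (-) b.

Definition circs (M : negModule R) : set M := range (@circ M).
Arguments circs M : clear implicits.

Definition null (M : negModule R) : set M := [set a | 0 <~ a].
Arguments null M : clear implicits.

Definition prec_null (M : negModule R) (b b' : M) : Prop :=
  exists2 c, null M c & b + c = b'.

Definition dsum (M N : negModule R) : negModule R :=
  @NegModule R (M * N)%type
    (fun x => ((-) x.1, (-) x.2))
    (fun x y => x.1 <~ y.1 /\ x.2 <~ y.2).

(* Below, T is the set of scalars of the T-module structure and TM is the set
   of tangible elements of M. *)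

Definition negation_map (T : set R) (M : negModule R) : Prop :=
  [/\ (-) (0 : M) = 0,
      forall b c : M, (-) (b + c) = (-) b + (-) c,
      forall b : M, (-) (-) b = b
    & forall (a : R) (b : M), T a -> (-) (a *: b) = a *: (-) b].

Record surpassing (T : set R) (M : negModule R) (TM : set M) : Prop := {
  prec_refl : forall b : M, b <~ b;
  prec_trans : forall b c d : M, b <~ c -> c <~ d -> b <~ d;
  prec_circ : forall c : M, 0 <~ circ c;
  prec_neg : forall b1 b2 : M, b1 <~ b2 -> (-) b1 <~ (-) b2;
  prec_add : forall b1 b2 b1' b2' : M,
    b1 <~ b2 -> b1' <~ b2' -> b1 + b1' <~ b2 + b2';
  prec_scale : forall (a : R) (b1 b2 : M),
    T a -> b1 <~ b2 -> a *: b1 <~ a *: b2;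
  prec_tang : forall a b : M, TM a -> TM b -> a <~ b -> a = b
}.

Definition pseudo_triple (T : set R) (M : negModule R) (TM : set M) : Prop :=
  negation_map T M /\ @neg R M @` TM = TM.

Definition add_generates (M : negModule R) (X : set M) : Prop :=
  forall b : M, exists2 s : seq M,
    forall x, x \in s -> X x & b = \sum_(x <- s) x.

Definition triple (T : set R) (M : negModule R) (TM : set M) : Prop :=
  [/\ pseudo_triple T TM,
      TM `&` circs M = set0
    & add_generates (TM `|` [set 0])].

Definition unique_quasi_negatives (M : negModule R) (TM : set M) : Prop :=
  forall a, TM a -> unique (fun b => TM b /\ 0 <~ a + b) ((-) a).

Definition pseudo_system (T : set R) (M : negModule R) (TM : set M) : Prop :=
  [/\ pseudo_triple T TM, surpassing T TM & unique_quasi_negatives TM].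

Definition system (T : set R) (M : negModule R) (TM : set M) : Prop :=
  [/\ triple T TM, surpassing T TM & unique_quasi_negatives TM].

Definition spans (M : negModule R) (X : set M) : Prop :=
  forall b : M, exists2 s : seq (R * M),
    forall p, p \in s -> X p.2 & b = \sum_(p <- s) p.1 *: p.2.

End NegModules.

Arguments circs {R} M _.
Arguments null {R} M _.

(* R^o is R as a module over itself, so *: is the multiplication of R. *)
Record semiringSystem := SemiringSystem {
  ss_ring :> pzSemiRingType;
  ss_neg : ss_ring -> ss_ring;
  ss_prec : ss_ring -> ss_ring -> Prop;
  tang : set ss_ring;
  ss_mod := @NegModule ss_ring ss_ring^o ss_neg ss_prec;
  ss_system : system tang (tang : set ss_mod)
}.

Record systemicModule (A : semiringSystem) := SystemicModule {
  sm_mod :> negModule A;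
  sm_tang : set sm_mod;
  sm_pseudo_system : pseudo_system (@tang A) sm_tang;
  sm_spans : spans sm_tang;
  sm_tang_scale : forall (a : A) (m : sm_mod),
    tang a -> sm_tang m -> sm_tang (a *: m);
  sm_neg_scale : forall (a : A) (m : sm_mod), ss_neg a *: m = (-) (a *: m);
  sm_prec_scale : forall (a1 a2 : A) (b1 b2 : sm_mod),
    ss_prec a1 a2 -> b1 <~ b2 -> a1 *: b1 <~ a2 *: b2
}.

Section Morphisms.
Variable A : semiringSystem.

Definition submodule (M : negModule A) (S : set M) : Prop :=
  [/\ S 0,
      forall b c, S b -> S c -> S (b + c),
      forall (a : A) b, S b -> S (a *: b)
    & forall b, S b -> S ((-) b)].

(* phi, restricted to the submodule D, is a homomorphism from D to N.  The
   values of phi outside D are irrelevant; D = setT gives homomorphisms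
   defined on all of M. *)
Record homomorphism_on (M N : negModule A) (D : set M) (phi : M -> N) : Prop :=
  { hom_submodule : submodule D;
    hom0 : phi 0 = 0;
    homN : forall b, D b -> phi ((-) b) = (-) phi b;
    homD : forall b c, D b -> D c -> phi (b + c) = phi b + phi c;
    homZ : forall (a : A) b, tang a -> D b -> phi (a *: b) = a *: phi b;
    hom_prec : forall b c, D b -> D c -> b <~ c -> phi b <~ phi c }.

Definition prec_onto (M N : negModule A) (f : M -> N) : Prop :=
  forall y : N, exists x : M, y <~ f x.

(* The kernels of the restriction of f to the submodule D. *)

Definition kerN (M N : negModule A) (D : set M) (f : M -> N) :
    set (dsum M M) :=
  [set z | [/\ D z.1, D z.2 & f z.1 = f z.2]].

Definition kerN_prec (M N : negModule A) (D : set M) (f : M -> N) :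
    set (dsum M M) :=
  [set z | [/\ D z.1, D z.2, f z.1 = f z.2, null N (f z.1) & null N (f z.2)]].

Definition null_submodule (M N : negModule A) (D : set M) (f : M -> N) :
    set (set M) :=
  [set S | [/\ submodule S, S `<=` D & f @` S `<=` null N]].

Definition sum_submodules (M : negModule A) (F : set (set M)) : set M :=
  [set x | exists2 s : seq M,
     forall y, y \in s -> exists2 S, F S & S y & x = \sum_(y <- s) y].

Definition kerMod (M N : negModule A) (D : set M) (f : M -> N) : set M :=
  sum_submodules (null_submodule D f).

Definition Pprec (P1 P2 M : negModule A) (f1 : P1 -> M) (f2 : P2 -> M) :
    set (dsum P1 P2) :=
  [set b | f1 b.1 <~ f2 b.2].

Definition proj1 (P1 P2 : negModule A) : dsum P1 P2 -> P1 := fst.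
Definition proj2 (P1 P2 : negModule A) : dsum P1 P2 -> P2 := snd.

Definition snd_diff (P1 P2 : negModule A)
    (z : dsum (dsum P1 P2) (dsum P1 P2)) : P2 :=
  z.1.2 (-) z.2.2.

End Morphisms.

Arguments proj1 {A P1 P2}.
Arguments proj2 {A P1 P2}.
Arguments snd_diff {A P1 P2}.

(* Main.v *)
Require Import Defs.

Set Implicit Arguments.
Unset Strict Implicit.
Unset Printing Implicit Defensive.

(** The null elements of a systemic module form a submodule, and a homomorphism,
    although only assumed to commute with tangible scalars, commutes with all
    of them because the tangible elements generate the semiring
    (homomorphism_scale).  Hence the elements that a homomorphism [f] sends to
    null elements already form a submodule.  It is the largest [f]-null one,
    so the sum of all the [f]-null submodules is just this set (kerModE): both
    statements about module kernels reduce to deciding when a value is null.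

    Everything else is monotonicity.  Compatibility of the relation with the
    operations makes [Pprec f1 f2] a submodule, and surjectivity of its first
    projection is exactly the [prec_onto] property of [f2].  If [(b1, b2)] lies
    in [Pprec f1 f2] with [b1] null, then [0 <~ f1 b1 <~ f2 b2], so [f2 b2] is
    null (Pprec_null).  This gives the description of the module kernel of the
    projection; applied to two pairs with null first coordinates, it shows that
    [f2 b2 (-) f2 b2'] is null, that is, that [b2 (-) b2'] lies in the
    module kernel of [f2]. *)

Section SystemicModuleTheory.
Variables (A : semiringSystem) (N : systemicModule A).

Lemma sm_surpassing : surpassing (@tang A) (@sm_tang A N).
Proof. by case: (sm_pseudo_system N). Qed.

Lemma sm_negation_map : negation_map (@tang A) N.
Proof. by case: (sm_pseudo_system N) => [[]]. Qed.

Lemma sm_neg0 : (-) (0 : N) = 0.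
Proof. by case: sm_negation_map. Qed.

Lemma sm_negD (b c : N) : (-) (b + c) = (-) b + (-) c.
Proof. by case: sm_negation_map. Qed.

Lemma sm_negZ (a : A) (b : N) : tang a -> (-) (a *: b) = a *: (-) b.
Proof. by case: sm_negation_map => _ _ _; apply. Qed.

(** Compatibility of the relation with an arbitrary scalar comes from its
    compatibility with a relation between two scalars, by reflexivity. *)
Lemma sm_prec_scalel (a : A) (b c : N) : b <~ c -> a *: b <~ a *: c.
Proof.
apply: sm_prec_scale.
by case: (ss_system A) => _ /prec_refl + _; apply.
Qed.

Lemma submodule_null : submodule (null N).
Proof.
have sN := sm_surpassing; split=> [|b c b0 c0|a b b0|b b0]; rewrite /null /=.
- exact: (prec_refl sN).
- by rewrite -[0]addr0; apply: (prec_add sN).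
- by rewrite -(scaler0 _ a); apply: sm_prec_scalel.
- by rewrite -sm_neg0; apply: (prec_neg sN).
Qed.

Lemma submodule_nullB (b c : N) : null N b -> null N c -> null N (b (-) c).
Proof. by case: submodule_null => _ nD _ nN nb nc; apply: nD (nN _ nc). Qed.

End SystemicModuleTheory.

Section Homomorphisms.
Variables (A : semiringSystem) (M : negModule A).

Lemma submodule_sum (S : set M) (s : seq M) :
  submodule S -> (forall x, x \in s -> S x) -> S (\sum_(x <- s) x).
Proof.
move=> [S0 SD _ _] sS; rewrite big_seq.
by apply: (big_ind S) => // x; apply: sS.
Qed.

(** Both sides are additive in the scalar, which is a sum of tangible elements
    and zeros. *)
Lemma homomorphism_scale (N : negModule A) (D : set M) (phi : M -> N)
    (a : A) (b : M) :
  homomorphism_on D phi -> D b -> phi (a *: b) = a *: phi b.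
Proof.
move=> hphi Db; have [_ DD DZ _] := hom_submodule hphi.
have [[_ _ gen] _ _] := ss_system A.
have [s sT ->] := gen a.
elim: s sT => [|x s IHs] sT.
  by rewrite big_nil !scale0r (hom0 hphi).
rewrite big_cons !scalerDl (homD hphi); [|exact: DZ..].
congr (_ + _); last by apply: IHs => y ys; apply: sT; rewrite inE ys orbT.
have [xT|/= ->] := sT x (mem_head x s); first exact: (homZ hphi).
by rewrite !scale0r (hom0 hphi).
Qed.

Lemma submodule_kerN (N : negModule A) (D : set M) (phi : M -> N) :
  homomorphism_on D phi -> submodule (kerN D phi).
Proof.
move=> hphi; have [D0 DD DZ DN] := hom_submodule hphi.
split=> [//|[x y] [x' y']|a [x y]|[x y]] /=.
- move=> [/= Dx Dy e] [/= Dx' Dy' e']; split=> /=; [exact: DD..|].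
  by rewrite !(homD hphi) // e e'.
- move=> [/= Dx Dy e]; split=> /=; [exact: DZ..|].
  by rewrite !(homomorphism_scale _ hphi) // e.
- move=> [/= Dx Dy e]; split=> /=; [exact: DN..|].
  by rewrite !(homN hphi) // e.
Qed.

Variables (N : systemicModule A) (D : set M) (phi : M -> N).
Hypothesis hphi : homomorphism_on D phi.

Lemma submodule_preimage_null : submodule [set x | D x /\ null N (phi x)].
Proof.
have [D0 DD DZ DN] := hom_submodule hphi.
have [n0 nD nZ nN] := submodule_null N.
split=> [|b c [Db nb] [Dc nc]|a b [Db nb]|b [Db nb]] /=.
- by rewrite (hom0 hphi).
- by rewrite (homD hphi) //; split; [apply: DD|apply: nD].
- by rewrite (homomorphism_scale _ hphi) //; split; [apply: DZ|apply: nZ].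
- by rewrite (homN hphi) //; split; [apply: DN|apply: nN].
Qed.

(** The set on the right is itself a [phi]-null submodule, and it contains
    every other one, hence also their sum. *)
Lemma kerModE : kerMod D phi = [set x | D x /\ null N (phi x)].
Proof.
apply/seteqP; split=> x.
  move=> [s sP ->]; apply: (submodule_sum submodule_preimage_null) => y.
  move=> /sP [S [_ SD Snull] Sy].
  by split; [apply: SD|apply: Snull; exists y].
move=> Kx; exists [:: x]; last by rewrite big_seq1.
move=> y; rewrite inE => /eqP ->; exists [set z | D z /\ null N (phi z)] => //.
split; first exact: submodule_preimage_null.
- by move=> z [].
- by move=> _ [z [_ nz] <-].
Qed.

Lemma kerN_prec_sub : kerN_prec D phi `<=` kerN D phi.
Proof. by move=> z []. Qed.

Lemma submodule_kerN_prec : submodule (kerN_prec D phi).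
Proof.
have [K0 KD KZ KN] := submodule_kerN hphi.
have [L0 LD LZ LN] := submodule_preimage_null.
(* On the kernel pair, nullity of one of the two equal values suffices. *)
have kerN_precE z : kerN_prec D phi z <-> kerN D phi z /\ null N (phi z.1).
  split=> [[Dx Dy e nx _] //|[[Dx Dy e] nx]].
  by split=> //; rewrite -e.
split=> [|x y|a x|x]; rewrite !kerN_precE.
- by split=> //; case: L0.
- move=> [Kx nx] [Ky ny]; split; first exact: KD.
  case: Kx Ky => [Dx _ _] [Dy _ _].
  by case: (LD x.1 y.1).
- move=> [Kx nx]; split; first exact: KZ.
  by case: Kx => [Dx _ _]; case: (LZ a x.1).
- move=> [Kx nx]; split; first exact: KN.
  by case: Kx => [Dx _ _]; case: (LN x.1).
Qed.

End Homomorphisms.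

Section Pullback.
Variables (A : semiringSystem) (P1 P2 M : systemicModule A).

Lemma proj1_homomorphism (D : set (dsum P1 P2)) :
  submodule D -> homomorphism_on D proj1.
Proof. by move=> sD; split=> // b c _ _ []. Qed.

(** Addition and negation of [P2] respect each other, the tangible scalars and
    the relation, and hence so does subtraction.  The domain [D] is arbitrary
    because this is applied to both [kerN] and [kerN_prec]. *)
Lemma snd_diff_homomorphism (D : set (dsum (dsum P1 P2) (dsum P1 P2))) :
  submodule D -> homomorphism_on D (snd_diff : _ -> P2).
Proof.
move=> sD; split=> //; rewrite /snd_diff /=.
- by rewrite sm_neg0 addr0.
- by move=> b _; rewrite sm_negD.
- by move=> b c _ _; rewrite sm_negD addrACA.
- by move=> a b aT _; rewrite sm_negZ // scalerDr.
- move=> b c _ _ [[_ bc] [_ bc']].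
  have sP2 := sm_surpassing P2.
  by apply: (prec_add sP2) => //; apply: (prec_neg sP2).
Qed.

Variables (f1 : P1 -> M) (f2 : P2 -> M).
Hypotheses (hf1 : homomorphism_on setT f1) (hf2 : homomorphism_on setT f2).

Lemma submodule_Pprec : submodule (Pprec f1 f2).
Proof.
have sM := sm_surpassing M; rewrite /Pprec.
split=> [|b c bP cP|a b bP|b bP] /=.
- by rewrite (hom0 hf1) (hom0 hf2); apply: (prec_refl sM).
- by rewrite (homD hf1) // (homD hf2) //; apply: (prec_add sM).
- rewrite (homomorphism_scale _ hf1) // (homomorphism_scale _ hf2) //.
  exact: sm_prec_scalel.
- by rewrite (homN hf1) // (homN hf2) //; apply: (prec_neg sM).
Qed.

Lemma Pprec_null (b : dsum P1 P2) :
  Pprec f1 f2 b -> null P1 b.1 -> null M (f2 b.2).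
Proof.
move=> Pb b0; apply: (prec_trans (sm_surpassing M)) Pb.
by rewrite -(hom0 hf1); apply: (hom_prec hf1).
Qed.

Lemma kerN_prec_null_diff (z : dsum (dsum P1 P2) (dsum P1 P2)) :
  kerN_prec (Pprec f1 f2) (proj1 : _ -> P1) z ->
  null M (f2 z.1.2 (-) f2 z.2.2).
Proof.
move=> [Pz1 Pz2 _ n1 n2].
by apply: submodule_nullB; apply: Pprec_null.
Qed.

Lemma f2_snd_diff (z : dsum (dsum P1 P2) (dsum P1 P2)) :
  f2 (snd_diff z) = f2 z.1.2 (-) f2 z.2.2.
Proof. by rewrite (homD hf2) // (homN hf2). Qed.

End Pullback.

Theorem lemma5p5 (A : semiringSystem) (P1 P2 M : systemicModule A)
    (precA : forall b b' : ss_mod A, b <~ b' <-> prec_null b b')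
    (precP1 : forall b b' : P1, b <~ b' <-> prec_null b b')
    (precP2 : forall b b' : P2, b <~ b' <-> prec_null b b')
    (precM : forall b b' : M, b <~ b' <-> prec_null b b')
    (f1 : P1 -> M) (f2 : P2 -> M)
    (hf1 : homomorphism_on setT f1) (hf2 : homomorphism_on setT f2)
    (f2_onto : prec_onto f2) :
  let P : set (dsum P1 P2) := Pprec f1 f2 in
  let pi1 : dsum P1 P2 -> P1 := proj1 in
  let pi2 : dsum P1 P2 -> P2 := proj2 in
  let pi : dsum (dsum P1 P2) (dsum P1 P2) -> P2 := snd_diff in
  [/\ submodule P /\ set_surj P setT pi1,
      [/\ homomorphism_on (kerN P pi1) pi,
          kerN_prec P pi1 `<=` kerN P pi1,
          homomorphism_on (kerN_prec P pi1) pi,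
          (pi @` kerN_prec P pi1 `<=`
             [set y | exists b2 b2' : P2,
                y = b2 (-) b2' /\ null M (f2 b2 (-) f2 b2')])
          /\ (null M `<=` circs M ->
              pi @` kerN_prec P pi1 `<=`
                [set y | exists b2 b2' : P2,
                   y = b2 (-) b2' /\ circs M (f2 b2 (-) f2 b2')])
        & pi @` kerN_prec P pi1 `<=` kerMod setT f2],
      kerMod P pi1 = [set b | [/\ P b, 0 <~ b.1 & kerMod setT f2 b.2]]
    & forall b, P b -> f1 (pi1 b) <~ f2 (pi2 b)].

Proof.
move=> P pi1 pi2 pi.
have sP : submodule P := submodule_Pprec hf1 hf2.
have hpi1 : homomorphism_on P pi1 := proj1_homomorphism sP.
split=> //.
- split=> // y _; have [x yx] := f2_onto (f1 y).
  by exists (y, x).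
- split.
  + exact: snd_diff_homomorphism (submodule_kerN hpi1).
  + exact: kerN_prec_sub.
  + exact: snd_diff_homomorphism (submodule_kerN_prec hpi1).
  + split=> [|null_circ] _ [z /(kerN_prec_null_diff hf1) nz <-];
      exists z.1.2, z.2.2; split=> //.
    exact: null_circ.
  + move=> _ [z /(kerN_prec_null_diff hf1) nz <-].
    by rewrite (kerModE hf2); split; rewrite // (f2_snd_diff hf2).
- rewrite (kerModE hpi1) (kerModE hf2).
  apply/seteqP; split=> b [Pb]; last by [].
  by move=> nb; split=> //; split=> //; apply: (Pprec_null hf1 Pb).
Qed.
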